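(* Let $(X,d)$ be a metric space (not necessarily compact). Then every co-compact open cover of $X$ has a Lebesgue number; that is, for every co-compact open cover $\mathcal{U}$ of $X$ there exists a real number $\delta>0$ such that every open subset $O$ of $X$ with $\mathrm{diam}(O)<\delta$ is contained in some element of $\mathcal{U}$.
   Context: An open set $U\subseteq X$ is co-compact if $X\setminus U$ is a compact subset of $X$. A co-compact open cover of $X$ is an open cover of $X$ all of whose elements are co-compact. For $A\subseteq X$, $\mathrm{diam}(A)=\sup\{d(x,y): x,y\in A\}$. The space $X$ is non-empty. *)

(* Defs.v *)
From HB Require Import structures.
From mathcomp Require Import all_boot all_order all_algebra.
From mathcomp Require Import all_classical all_reals all_analysis.

Set Implicit Arguments.
Unset Strict Implicit.
Unset Printing Implicit Defensive.

Import Order.TTheory GRing.Theory Num.Theory.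
Import numFieldNormedType.Exports.

Local Open Scope classical_set_scope.
Local Open Scope ring_scope.

Definition co_compact (X : topologicalType) (U : set X) : Prop :=
  open U /\ compact (~` U).

Definition co_compact_open_cover (X : topologicalType) (C : set (set X)) : Prop :=
  (forall U, C U -> co_compact U) /\ cover C id = [set: X].

(* The supremum is taken in the extended reals: unbounded sets have diameter
   +oo, and the empty set has diameter -oo, which is below every positive
   bound just as the value 0 would be. *)
Definition diam (R : realType) (X : metricType R) (A : set X) : \bar R :=
  ereal_sup [set (mdist p.1 p.2)%:E | p in A `*` A].

Definition lebesgue_number (R : realType) (X : metricType R)
    (C : set (set X)) (delta : R) : Prop :=
  0 < delta /\
  forall O : set X, open O -> (diam O < delta%:E)%E ->
    exists2 U, C U & O `<=` U.

(* Main.v *)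
(* One member [U0] of the cover has compact complement [K]. By compactness there
   is [delta > 0] such that every ball of radius [delta] centred in [K] lies in a
   member of the cover. A set of diameter less than [delta] either misses [K], so
   lies in [U0], or lies in the ball of radius [delta] around one of its points
   in [K]. *)
Require Import Defs.
From mathcomp Require Import all_boot all_order all_algebra.
From mathcomp Require Import all_classical all_reals all_analysis.

Import Order.TTheory GRing.Theory Num.Theory.

Local Open Scope classical_set_scope.
Local Open Scope ring_scope.

(** In near-covering form, compactness makes uniform over [K] any property that holds near each
    point of [K] for all small [delta > 0]. *)
Lemma compact_lebesgue_number (R : realType) (X : pseudoMetricType R)
    (K : set X) (C : set (set X)) :
  compact K -> (forall U, C U -> open U) -> K `<=` cover C id ->
  exists2 delta : R, 0 < delta &
    forall x, K x -> exists2 U, C U & ball x delta `<=` U.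
Proof.
move=> /compact_near_coveringP Kc Copen KC.
pose P (delta : R) x := exists2 U, C U & ball x delta `<=` U.
have : \forall delta \near 0^'+, K `<=` P delta.
  apply: (Kc _ _ P) => x /KC [U CU Ux].
  have /nbhs_ballP[r /= r0 rU] : nbhs x U.
    by apply: open_nbhs_nbhs; split => //; exact: Copen.
  have r20 : 0 < r / 2 by rewrite divr_gt0.
  (* Halving [r] leaves room for the triangle inequality: for [y] within [r / 2] of [x], the
     [delta]-ball at [y] stays in [ball x r]. *)
  exists (ball x (r / 2), [set delta | delta < r / 2]).
    by split; [exact: nbhsx_ballx | exact: nbhs_right_lt].
  move=> [y delta] /= [xy deltar]; exists U => // z yz; apply: rU.
  rewrite (splitr r); apply: ball_triangle xy _.
  exact: le_ball (ltW deltar) _ yz.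
move=> KP; have [delta [delta0 Pdelta]] := filter_ex (filterI (nbhs_right_gt 0) KP).
by exists delta.
Qed.

Lemma diam_lt_subset_ball (R : realType) (X : metricType R) (A : set X)
    (r : R) (x : X) :
  (diam A < r%:E)%E -> A x -> A `<=` ball x r.
Proof.
move=> Ar Ax y Ay; rewrite ballEmdist /= -lte_fin.
by apply: le_lt_trans Ar; apply: ereal_sup_ubound; exists (x, y).
Qed.

Theorem theorem5p1 (R : realType) (X : metricType R)
    (X_nonempty : [set: X] !=set0) (C : set (set X))
    (C_cover : co_compact_open_cover C) :
  exists delta : R, lebesgue_number C delta.
Proof.
case: C_cover X_nonempty => Ccc CT [x0 _].
(* Covering a point forces [C] to have a member. *)
have [U0 CU0 _] : cover C id x0 by rewrite CT.
have [delta delta0 deltaP] : exists2 delta : R, 0 < delta &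
    forall x, (~` U0) x -> exists2 U, C U & ball x delta `<=` U.
  apply: compact_lebesgue_number; first exact: (Ccc _ CU0).2.
    by move=> U /Ccc[].
  by rewrite CT.
exists delta; split=> // O _ Odelta.
have [OU0|/existsNP[x /not_implyP[Ox U0x]]] := pselect (O `<=` U0).
  by exists U0.
have [U CU xU] := deltaP x U0x.
by exists U => //; apply: subset_trans xU; exact: diam_lt_subset_ball.
Qed.
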